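(* Let $p>1$, let $\Gamma$ be a connected simple graph with $N$ vertices, and let $F=\{f_i\}_{i=1}^N$ be an $\mathcal{L}_\Gamma(N,N-1)$-frame for $\mathbb{C}^{N-1}$ such that $\sum_{i=1}^N f_i=0$. Then $(F,S_F^{-1}F)\in\mathcal{E}_1^p$. Further, $F$ has no other dual $G'$ (i.e. no dual $G'\ne S_F^{-1}F$) such that $(F,G')\in\mathcal{E}_1^p$.
   Context: A sequence $F=\{f_i\}_{i=1}^N$ in an $n$-dimensional Hilbert space $\mathcal{H}$ is a frame if there are $A,B>0$ with $A\|f\|^2\le\sum_{i=1}^N|\langle f,f_i\rangle|^2\le B\|f\|^2$ for all $f\in\mathcal{H}$. Its analysis operator is $\Theta_F f=(\langle f,f_i\rangle)_{i=1}^N$, with adjoint $\Theta_F^*(c_i)_i=\sum_i c_if_i$; the frame operator is $S_F=\Theta_F^*\Theta_F$ (positive and invertible). A frame $G=\{g_i\}_{i=1}^N$ is a dual of $F$ if $f=\sum_{i=1}^N\langle f,f_i\rangle g_i$ for all $f$; then $(F,G)$ is an $(N,n)$ dual pair. The canonical dual is $S_F^{-1}F=\{S_F^{-1}f_i\}_{i=1}^N$. Let $\mathcal{D}^{(1)}$ be the set of $N\times N$ diagonal matrices with exactly one diagonal entry equal to $1$ and all others $0$; $\rho$ is the spectral radius. Define $\mathcal{E}_1^p(F,G)=\Big\{\frac1N\sum_{D\in\mathcal{D}^{(1)}}\big(\rho(\Theta_G^*D\Theta_F)\big)^p\Big\}^{1/p}$, $\delta_1^p=\inf\{\mathcal{E}_1^p(F,G):(F,G)\text{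 an }(N,n)\text{ dual pair}\}$, and let $\mathcal{E}_1^p$ be the set of $(N,n)$ dual pairs with $\mathcal{E}_1^p(F,G)=\delta_1^p$. (Superscript $p$ is an index, not a power.) Here $\mathcal{H}=\mathbb{C}^{N-1}$, $n=N-1$. For a simple graph $\Gamma$ on vertices $v_1,\dots,v_N$, the Laplacian is $\mathcal{L}(\Gamma)=\mathcal{D}(\Gamma)-\mathcal{A}(\Gamma)$, with $\mathcal{D}(\Gamma)$ the diagonal degree matrix and $\mathcal{A}(\Gamma)$ the adjacency matrix. If $\Gamma$ has $N-n$ connected components, write $\mathcal{L}(\Gamma)=M\,\mathrm{diag}(\lambda_1,\dots,\lambda_n,0,\dots,0)M^*$ with $\lambda_1,\dots,\lambda_n$ the nonzero eigenvalues and $M$ a unitary matrix of corresponding eigenvectors; let $M_1$ consist of the first $n$ columns of $M$ and $B=\mathrm{diag}(\sqrt{\lambda_1},\dots,\sqrt{\lambda_n})M_1^*$. Any frame of the form $\{Be_i\}_{i=1}^N$, with $(e_i)$ the standard basis of $\mathbb{C}^N$, is called an $\mathcal{L}_\Gamma(N,n)$-frame; its Gramian matrix $\Theta_F\Theta_F^*$ is $\mathcal{L}(\Gamma)$. *)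

(* Defs.v *)
From mathcomp Require Import all_boot all_order all_algebra.
From mathcomp Require Import all_classical all_reals all_analysis.
From mathcomp Require Export complex.

Set Implicit Arguments.
Unset Strict Implicit.
Unset Printing Implicit Defensive.

Import Order.TTheory GRing.Theory Num.Theory.

Local Open Scope classical_set_scope.
Local Open Scope complex_scope.
Local Open Scope ring_scope.
Local Open Scope sesquilinear_scope.

Section Frames.
Variable R : realType.
Local Notation C := R[i].
Local Notation vectors N n := ('I_N -> 'cV[C]_n).

(* Linear in the first argument, conjugate-linear in the second. *)
Definition inner (n : nat) (f g : 'cV[C]_n) : C :=
  \sum_(k < n) f k 0 * (g k 0)^*.

(* The inequalities are between real elements of C. *)
Definition is_frame (N n : nat) (F : vectors N n) : Prop :=
  exists A B : R, [/\ 0 < A, 0 < B &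
    forall f : 'cV[C]_n,
      A%:C * inner f f <= \sum_(i < N) `|inner f (F i)| ^+ 2 <= B%:C * inner f f].

(* Row i is the adjoint of F i, so that (analysis F *m f) i 0 = inner f (F i). *)
Definition analysis (N n : nat) (F : vectors N n) : 'M[C]_(N, n) :=
  \matrix_(i < N, k < n) (F i k 0)^*.

Definition frame_operator (N n : nat) (F : vectors N n) : 'M[C]_n :=
  (analysis F)^t* *m analysis F.

Definition canonical_dual (N n : nat) (F : vectors N n) : vectors N n :=
  fun i => invmx (frame_operator F) *m F i.

Definition dual_pair (N n : nat) (F G : vectors N n) : Prop :=
  [/\ is_frame F, is_frame G &
      forall f : 'cV[C]_n, f = \sum_(i < N) inner f (F i) *: G i].

(* [sup set0 = 0] gives the value 0 when n = 0. *)
Definition spectral_radius (n : nat) (A : 'M[C]_n) : R :=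
  sup [set r | exists2 a : C, eigenvalue A a & r = Normc.normc a].

Definition one_erasures (N : nat) : set 'M[C]_N :=
  [set D | is_diag_mx D /\
           exists i, D i i = 1 /\ forall j, j != i -> D j j = 0].

(* [one_erasures N] has N elements, so the [\in]-sum is the ordinary finite
   sum over it. *)
Definition erasure_error (p : R) (N n : nat) (F G : vectors N n) : R :=
  (N%:R^-1 *
   \sum_(D \in @one_erasures N)
      spectral_radius ((analysis G)^t* *m D *m analysis F) `^ p) `^ p^-1.

Definition optimal_error (p : R) (N n : nat) : R :=
  inf [set r | exists F G : vectors N n,
                 dual_pair F G /\ r = erasure_error p F G].

Definition optimal_pairs (p : R) (N n : nat) : set (vectors N n * vectors N n) :=
  [set FG | dual_pair FG.1 FG.2 /\
            erasure_error p FG.1 FG.2 = optimal_error p N n].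

Definition laplacian (N : nat) (e : rel 'I_N) : 'M[C]_N :=
  diag_mx (\row_i #|[set j | e i j]%SET|%:R) - \matrix_(i, j) (e i j)%:R.

(* The eigenvalues [lam] are listed with the n nonzero ones first; they are
   automatically positive, the Laplacian being positive semidefinite. *)
Definition laplacian_frame (N n : nat) (e : rel 'I_N) (F : vectors N n) : Prop :=
  exists (le_nN : (n <= N)%N) (M : 'M[C]_N) (lam : 'I_N -> R),
    [/\ n_comp e 'I_N = (N - n)%N,
        M \is unitarymx,
        forall j, (lam j != 0) = (j < n)%N,
        laplacian e = M *m diag_mx (\row_j (lam j)%:C) *m M^t* &
        let M1 : 'M[C]_(N, n) := colsub (widen_ord le_nN) M in
        let B := diag_mx (\row_k (Num.sqrt (lam (widen_ord le_nN k)))%:C) *m M1^t* in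
        is_frame F /\ forall i, F i = B *m delta_mx i 0].

End Frames.

(* Main.v *)
Require Import Defs.
From mathcomp Require Import all_boot all_order all_algebra.
From mathcomp Require Import all_classical all_reals all_analysis.
From mathcomp Require Import ring lra.

Import Order.TTheory GRing.Theory Num.Theory.

Local Open Scope ring_scope.

Set Implicit Arguments.
Unset Strict Implicit.
Unset Printing Implicit Defensive.

(** For [D] the [i]-th one-erasure, the operator Theta_G^* D Theta_F is the
    rank-one matrix G_i F_i^*, so its spectral radius is |<G_i, F_i>|
    ([spectral_radius_rank1], [erasure_errorE]).  When [G] is a dual of [F], the
    numbers <G_i, F_i> sum to the trace of the identity of C^n, that is, to n
    ([sum_inner_dual]).  The strict power mean inequality ([power_mean_normc])
    then shows that every dual pair has error at least n / N, with equality
    exactly when <G_i, F_i> = n / N for all [i] ([erasure_error_leif]).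

    Let N = n + 1 and let [F] be a frame with zero sum.  The left kernel of
    Theta_F has dimension one and contains the all-ones vector 1, so that it is
    the line spanned by 1.  With Phi the synthesis operator of the canonical
    dual, I - Theta_F Phi has its rows in this kernel and fixes 1, hence it is
    J / N with J the all-ones matrix.  Its diagonal gives <G_i, F_i> = n / N for
    the canonical dual, which is therefore optimal ([inner_canonical_dual]).

    Any other dual has the form G_i = S_F^-1 F_i + h, with [h] independent of
    [i], by the same description of the kernel; if it is optimal, then
    <h, F_i> = 0 for all [i], and h = 0 because [F] is a frame
    ([zero_sum_dual_eq]).  For N = 1 the space is zero and any two families are
    equal. *)

Local Open Scope complex_scope.

(** * A strict power mean inequality *)

Section PowerMean.
Variable R : realType.
Implicit Types (p m y q : R).

Lemma ln_leif q : 0 < q -> ln q <= q - 1 ?= iff (q == 1).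
Proof.
move=> q0; apply/leifP; case: eqP => [->|/eqP q1]; first by rewrite ln1 subrr.
have q10 : q - 1 != 0 by rewrite subr_eq0.
by rewrite -ltr_expR lnK//; have := expR_gt1Dx q10; rewrite addrC subrK.
Qed.

Lemma bernoulli_powR p y : 1 < p -> 0 <= y ->
  1 + p * (y - 1) <= y `^ p ?= iff (y == 1).
Proof.
move=> p1 y0; have p0 : 0 < p by lra.
apply/leifP; case: eqP => [->|/eqP y1]; first by rewrite powR1 subrr mulr0 addr0.
move: y0; rewrite le_eqVlt => /predU1P[<-|y0].
  by rewrite powR0 ?gt_eqF//; lra.
have u0 : 0 < y `^ p by rewrite powR_gt0.
have lnu : ln (y `^ p) = p * ln y by rewrite ln_powR.
have u1 : y `^ p != 1.
  by rewrite -(ln_eq0 u0) lnu mulf_eq0 gt_eqF//= ln_eq0.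
move: (y `^ p) u0 lnu u1 => u u0 lnu u1.
(* [mu] is the mean of [u = y ^ p] and [1] with weights [1/p] and [1 - 1/p].
   The sum, with these weights, of the bounds [ln q <= q - 1] at [q = u / mu]
   (strict) and at [q = 1 / mu] gives [ln y < ln mu]. *)
set mu := p^-1 * u + (1 - p^-1).
have mu0 : 0 < mu by rewrite ltr_pwDl ?mulr_gt0 ?invr_gt0// subr_ge0 invf_le1// ltW.
have umu : u / mu != 1.
  apply: contra u1 => /eqP um.
  have {um} um : u = mu by rewrite -[LHS](divfK (lt0r_neq0 mu0)) um mul1r.
  have pV1 : 1 - p^-1 != 0 by rewrite subr_eq0 eq_sym invr_eq1 gt_eqF.
  apply/eqP/(mulfI pV1); rewrite mulr1.
  by rewrite mulrBl mul1r {1}um /mu addrAC subrr add0r.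
have lt1 : ln u - ln mu < u / mu - 1.
  have := ln_leif (divr_gt0 u0 mu0) => /lt_leif; rewrite ln_div ?posrE// umu.
  by [].
have le2 : - ln mu <= mu^-1 - 1.
  have mV0 : 0 < mu^-1 by rewrite invr_gt0.
  by have [+ _] := ln_leif mV0; rewrite lnV ?posrE.
have : ln y < ln mu.
  rewrite -subr_lt0 -(pmulr_rlt0 _ p0).
  have -> : p * (ln y - ln mu) = (ln u - ln mu) + (p - 1) * (- ln mu).
    by rewrite lnu; ring.
  have E : (u / mu - 1) + (p - 1) * (mu^-1 - 1) = 0.
    have -> : u = p * mu - p + 1 by rewrite /mu; field; rewrite gt_eqF.
    by field; rewrite gt_eqF.
  rewrite -[ltRHS]E; apply: ltr_leD => //.
  by rewrite ler_pM2l// subr_gt0.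
rewrite ltr_ln ?posrE// -(ltr_pM2l p0) /mu => ylt.
rewrite mulrDr mulrA divff ?gt_eqF// mul1r mulrBr divff ?gt_eqF// in ylt.
lra.
Qed.

Lemma normC_normc (x : R[i]) : `|x| = (Normc.normc x)%:C. Proof. by []. Qed.

Lemma Re_le_normc (x : R[i]) : complex.Re x <= Normc.normc x.
Proof.
rewrite -lecR -normC_normc (le_trans _ (normc_ge_Re x))// lecR.
exact: ler_norm.
Qed.

Lemma normc_Re_eq (x : R[i]) :
  complex.Re x = Normc.normc x -> x = (Normc.normc x)%:C.
Proof.
case: x => u v /= uE.
have : v ^+ 2 = 0.
  apply: (addrI (u ^+ 2)); rewrite addr0 [in RHS]uE sqr_sqrtr//.
  by rewrite addr_ge0// sqr_ge0.
by move=> /eqP; rewrite sqrf_eq0 => /eqP v0; rewrite -uE v0.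
Qed.

(** The tangent line of the p-th power at [m], taken at the real part of [a], lies
    below the p-th power of the modulus of [a]; equality holds only at [a = m],
    since it forces both [|a| = m] and [Re a = |a|]. *)
Lemma normc_powR_tangent p m (a : R[i]) : 1 < p -> 0 < m ->
  m `^ p * (1 + p * (complex.Re a / m - 1)) <= Normc.normc a `^ p
    ?= iff (a == m%:C).
Proof.
move=> p1 m0; have p0 : 0 < p by lra.
have n0 : 0 <= Normc.normc a by rewrite -ler0c -normC_normc.
have mp0 : 0 < m `^ p by rewrite powR_gt0.
have -> : Normc.normc a `^ p = m `^ p * (Normc.normc a / m) `^ p.
  by rewrite -powRM ?divr_ge0 ?(ltW m0)// mulrCA divff ?gt_eqF// mulr1.
have [le1 eq1] := bernoulli_powR p1 (divr_ge0 n0 (ltW m0)).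
have le2 : 1 + p * (complex.Re a / m - 1) <= 1 + p * (Normc.normc a / m - 1).
  rewrite lerD2l ler_pM2l// lerB// ler_pM2r ?invr_gt0//; exact: Re_le_normc.
apply/leifP; case: eqP => [->|/eqP am].
  have -> : Normc.normc m%:C = m.
    by apply: (@complexI R); rewrite -normC_normc ger0_norm// ler0c ltW.
  by rewrite /= divff ?lt0r_neq0// subrr mulr0 addr0 powR1.
rewrite ltr_pM2l//.
have [nm|nm] := eqVneq (Normc.normc a) m; last first.
  apply: (le_lt_trans le2); rewrite lt_neqAle eq1 le1 andbT.
  by apply: contra nm => /eqP E; rewrite -[X in X == _](divfK (lt0r_neq0 m0)) E mul1r.
apply: lt_le_trans le1; rewrite ltrD2l ltr_pM2l// ltrD2r ltr_pM2r ?invr_gt0//.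
rewrite lt_neqAle Re_le_normc andbT; apply: contra am => /eqP/normc_Re_eq ->.
by rewrite nm.
Qed.

Lemma power_mean_normc p m N (a : 'I_N -> R[i]) : 1 < p -> 0 < m -> (0 < N)%N ->
  \sum_i a i = (N%:R * m)%:C ->
  m `^ p <= N%:R^-1 * \sum_i Normc.normc (a i) `^ p
    ?= iff [forall i, a i == m%:C].
Proof.
move=> p1 m0 N0 suma; have N0' : 0 < N%:R :> R by rewrite ltr0n.
have := leif_sum (fun (i : 'I_N) (_ : true) => normc_powR_tangent (a i) p1 m0).
have -> : \sum_i m `^ p * (1 + p * (complex.Re (a i) / m - 1)) = N%:R * m `^ p.
  rewrite -mulr_sumr mulrC; congr (_ * _).
  rewrite big_split/= sumr_const card_ord -mulr_sumr big_split/= -mulr_suml.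
  rewrite sumr_const card_ord -(raddf_sum (@complex.Re R : Rcomplex R -> R)) suma/=.
  by rewrite mulfK ?gt_eqF// mulNrn subrr mulr0 addr0.
move=> [le eq]; split.
  by rewrite -(ler_pM2l N0') mulrA divff ?gt_eqF// mul1r.
rewrite -eq -(inj_eq (mulfI (lt0r_neq0 N0'))) mulrA divff ?lt0r_neq0//.
by rewrite mul1r.
Qed.

End PowerMean.

(** * Erasure errors of dual pairs *)

Local Open Scope sesquilinear_scope.

Section Frames.
Variable R : realType.
Local Notation C := R[i].
Local Notation vectors N n := ('I_N -> 'cV[C]_n).
(** The adjoint of the analysis operator; its columns are the vectors of the
    family. *)
Local Notation synthesis G := ((analysis G)^t*).

Lemma analysisE N n (F : vectors N n) f i : (analysis F *m f) i 0 = inner f (F i).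
Proof. by rewrite mxE; apply: eq_bigr => k _; rewrite mxE mulrC. Qed.

Lemma synthesis_coef N n (G : vectors N n) k i : synthesis G k i = G i k 0.
Proof. by rewrite !mxE conjCK. Qed.

Lemma synthesisE N n (G : vectors N n) (c : 'cV[C]_N) :
  synthesis G *m c = \sum_i c i 0 *: G i.
Proof.
apply/colP => k; rewrite mxE summxE; apply: eq_bigr => i _.
by rewrite synthesis_coef !mxE mulrC.
Qed.

Lemma reconstructionP N n (F G : vectors N n) :
  (forall f, f = \sum_i inner f (F i) *: G i) <->
  synthesis G *m analysis F = 1%:M.
Proof.
have E f : \sum_i inner f (F i) *: G i = synthesis G *m analysis F *m f.
  by rewrite -mulmxA synthesisE; apply: eq_bigr => i _; rewrite analysisE.
split=> [rec|GF f]; last by rewrite E GF mul1mx.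
apply/matrixP => k l.
have := congr1 (fun M : 'cV_n => M k 0) (rec (delta_mx l 0)).
by rewrite E -colE !mxE => <-; rewrite andbT.
Qed.

(** The sum is the trace of Theta_F Theta_G^*, hence that of
    Theta_G^* Theta_F = I. *)
Lemma sum_inner_dual N n (F G : vectors N n) :
  synthesis G *m analysis F = 1%:M -> \sum_i inner (G i) (F i) = n%:R.
Proof.
move=> GF; rewrite -(mxtrace1 C n) -GF mxtrace_mulC; apply: eq_bigr => i _.
by rewrite mxE; apply: eq_bigr => k _; rewrite synthesis_coef mxE mulrC.
Qed.

Lemma eigenvalue_rank1 n (u : 'cV[C]_n) (v : 'rV[C]_n) a :
  eigenvalue (u *m v) a -> a = 0 \/ a = (v *m u) 0 0.
Proof.
move=> /eigenvalueP[w].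
rewrite mulmxA [w *m u]mx11_scalar mul_scalar_mx => E w0.
have [->|a0] := eqVneq a 0; [by left | right].
have s0 : (w *m u) 0 0 != 0.
  apply: contra w0 => /eqP wu; move/eqP: E; rewrite wu scale0r eq_sym scaler_eq0.
  by rewrite (negPf a0).
have /(congr1 (fun M : 'M[C]_1 => M 0 0)) := congr1 (mulmxr u) E.
by rewrite /= -!scalemxAl [LHS]mxE [RHS]mxE mulrC => /(mulIf s0).
Qed.

Lemma eigenvalue_rank1_trace n (u : 'cV[C]_n) (v : 'rV[C]_n) : (0 < n)%N ->
  eigenvalue (u *m v) ((v *m u) 0 0).
Proof.
move=> n0; apply/eigenvalueP; have [->|v0] := eqVneq v 0.
  exists (const_mx 1); first by rewrite mulmx0 mul0mx mulmx0 mxE scale0r.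
  apply/eqP => /rowP/(_ (Ordinal n0)); rewrite !mxE; apply/eqP; exact: oner_neq0.
by exists v => //; rewrite mulmxA [v *m u in LHS]mx11_scalar mul_scalar_mx.
Qed.

Lemma spectral_radius_rank1 n (u : 'cV[C]_n) (v : 'rV[C]_n) : (0 < n)%N ->
  spectral_radius (u *m v) = Normc.normc ((v *m u) 0 0).
Proof.
move=> n0; set r := Normc.normc _; rewrite /spectral_radius; set A := (X in sup X).
have r0 : 0 <= r by rewrite -ler0c -normC_normc.
have Ar : A r by exists ((v *m u) 0 0) => //; exact: eigenvalue_rank1_trace.
have ubA : ubound A r.
  move=> _ [a /eigenvalue_rank1[->|->] ->//].
  by rewrite Normc.normc0.
apply/eqP; rewrite eq_le ge_sup//=; last by exists r.
by apply: ub_le_sup => //; exists r.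
Qed.

Lemma one_erasuresE N : @one_erasures R N = range (fun i : 'I_N => delta_mx i i).
Proof.
apply/seteqP; split=> [D [/is_diag_mxP Ddiag [i [Di Dj]]]|_ [i _ <-]].
  exists i => //; apply/matrixP => k l; rewrite mxE.
  have [<-|kl] := eqVneq k l; first by rewrite andbb; have [->|/Dj->] := eqVneq k i.
  rewrite Ddiag ?val_eqE//; have [ki|//] := eqVneq k i.
  by rewrite eq_sym -ki (negPf kl).
split.
  apply/is_diag_mxP => k l kl; rewrite mxE; case: (k =P i) => //= <-.
  by rewrite eq_sym -val_eqE (negPf kl).
by exists i; split=> [|j ji]; rewrite mxE ?eqxx// (negPf ji).
Qed.

Lemma sum_one_erasures N (f : 'M[C]_N -> R) :
  \sum_(D \in @one_erasures R N) f D = \sum_i f (delta_mx i i).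
Proof.
rewrite one_erasuresE fsbig_image; last first.
  move=> i j _ _ /matrixP/(_ i i); rewrite !mxE eqxx/= andbb.
  by case: eqP => // _ /eqP; rewrite oner_eq0.
rewrite (@fsbig_fwiden _ _ _ _ (index_enum 'I_N))//.
- by move=> i _ /=; rewrite mem_index_enum.
- exact: index_enum_uniq.
- by move=> i [_ []].
Qed.

Lemma erasure_errorE p N n (F G : vectors N n) : (0 < n)%N ->
  erasure_error p F G =
  (N%:R^-1 * \sum_i Normc.normc (inner (G i) (F i)) `^ p) `^ p^-1.
Proof.
move=> n0; rewrite /erasure_error sum_one_erasures; congr ((_ * _) `^ _).
apply: eq_bigr => i _.
have -> : synthesis G *m delta_mx i i *m analysis F = G i *m row i (analysis F).
  rewrite -(mul_delta_mx (0 : 'I_1)) mulmxA -mulmxA -rowE -colE; congr (_ *m _).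
  by apply/colP => k; rewrite mxE synthesis_coef.
rewrite spectral_radius_rank1//; congr (Normc.normc _ `^ p).
by rewrite -row_mul mxE analysisE.
Qed.

Lemma erasure_error_leif p N n (F G : vectors N n) :
  1 < p -> (0 < n)%N -> (0 < N)%N -> dual_pair F G ->
  n%:R / N%:R <= erasure_error p F G
    ?= iff [forall i, inner (G i) (F i) == (n%:R / N%:R)%:C].
Proof.
move=> p1 n0 N0 [_ _ /reconstructionP GF]; set m := n%:R / N%:R.
have p0 : 0 < p by lra.
have N0' : 0 < N%:R :> R by rewrite ltr0n.
have m0 : 0 < m by rewrite divr_gt0// ltr0n.
have suma : \sum_i inner (G i) (F i) = (N%:R * m)%:C.
  by rewrite (sum_inner_dual GF) /m mulrC divfK ?lt0r_neq0// rmorph_nat.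
have [le eq] := power_mean_normc p1 m0 N0 suma.
rewrite erasure_errorE//; set X := _ * _ in le eq *.
have X0 : 0 <= X by apply: le_trans le; exact: powR_ge0.
have mE : m = (m `^ p) `^ p^-1.
  by rewrite -powRrM divff ?lt0r_neq0// powRr1// ltW.
split.
  by rewrite mE ge0_ler_powR ?nnegrE ?invr_ge0 ?powR_ge0// ltW.
rewrite -eq {1}mE; apply/eqP/eqP => [|-> //].
by apply: powR_injective; rewrite ?nnegrE ?invr_gt0 ?powR_ge0.
Qed.

(** * Frames and left inverses of the analysis operator *)

Lemma inner_ge0 n (f : 'cV[C]_n) : 0 <= inner f f.
Proof. by apply: sumr_ge0 => k _; rewrite -normCK exprn_ge0. Qed.

Lemma inner_eq0 n (f : 'cV[C]_n) : inner f f = 0 -> f = 0.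
Proof.
move=> ff; apply/colP => k; rewrite mxE; apply/eqP.
rewrite -normr_eq0 -sqrf_eq0 normCK; apply/eqP.
by apply: (psumr_eq0P _ ff) => // i _; rewrite -normCK exprn_ge0.
Qed.

Lemma sum_inner_sqr N n (F : vectors N n) (f : 'cV[C]_n) :
  \sum_i `|inner f (F i)| ^+ 2 = inner (analysis F *m f) (analysis F *m f).
Proof. by apply: eq_bigr => i _; rewrite normCK analysisE. Qed.

Lemma frame_analysis_inj N n (F : vectors N n) (f : 'cV[C]_n) :
  is_frame F -> analysis F *m f = 0 -> f = 0.
Proof.
move=> [A [B [A0 _ /(_ f) /andP[+ _]]]] Ff; rewrite sum_inner_sqr Ff.
have -> : inner (0 : 'cV[C]_N) 0 = 0.
  by rewrite /inner big1// => i _; rewrite mxE mul0r.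
rewrite pmulr_rle0 ?ltcR// => ff0; apply: inner_eq0; apply/eqP.
by rewrite eq_le ff0 inner_ge0.
Qed.

Lemma mulmx_bounded m n (M : 'M[C]_(m, n)) : exists2 K : R, 0 < K &
  forall f : 'cV_n, inner (M *m f) (M *m f) <= K%:C * inner f f.
Proof.
(* The term 1 only makes the constant positive when [M] is zero. *)
exists (1 + \sum_i (\sum_k Normc.normc (M i k)) ^+ 2).
  by rewrite ltr_pwDl// sumr_ge0// => i _; rewrite sqr_ge0.
move=> f; set S := inner f f.
have S0 : 0 <= S := inner_ge0 f.
rewrite rmorphD rmorph1 mulrDl mul1r ler_wpDl// rmorph_sum mulr_suml.
apply: ler_sum => i _; rewrite -normCK rmorphXn/=.
rewrite -(sqrtCK S) -exprMn ler_pXn2r ?nnegrE ?mulr_ge0 ?sqrtC_ge0//; last first.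
  by rewrite ler0c sumr_ge0// => k _; rewrite -ler0c -normC_normc.
rewrite mxE (le_trans (ler_norm_sum _ _ _))// rmorph_sum mulr_suml.
apply: ler_sum => k _; rewrite normrM /= -normC_normc ler_wpM2l//.
rewrite -(@ler_pXn2r _ 2)// ?nnegrE ?sqrtC_ge0// sqrtCK normCK /S /inner (bigD1 k)//=.
by rewrite lerDl sumr_ge0// => l _; rewrite -normCK exprn_ge0.
Qed.

(** The lower frame bound is the inverse of the bound of the left inverse. *)
Lemma left_inverse_is_frame N n (F : vectors N n) (L : 'M[C]_(n, N)) :
  L *m analysis F = 1%:M -> is_frame F.
Proof.
move=> LF; have [K K0 hK] := mulmx_bounded L.
have [B B0 hB] := mulmx_bounded (analysis F).
exists K^-1, B; split; rewrite ?invr_gt0// => f; rewrite sum_inner_sqr hB andbT.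
rewrite fmorphV/= ler_pdivrMl ?ltcR//.
by have := hK (analysis F *m f); rewrite mulmxA LF mul1mx.
Qed.

Lemma synthesis_canonical_dual N n (F : vectors N n) :
  synthesis (canonical_dual F) = invmx (frame_operator F) *m synthesis F.
Proof.
apply/matrixP => k i; rewrite synthesis_coef !mxE; apply: eq_bigr => l _.
by rewrite synthesis_coef.
Qed.

Lemma adjmx_mul m n k (A : 'M[C]_(m, n)) (B : 'M[C]_(n, k)) :
  (A *m B)^t* = B^t* *m A^t*.
Proof. by rewrite trmx_mul map_mxM. Qed.

Lemma inner_adj n (f : 'cV[C]_n) : inner f f = (f^t* *m f) 0 0.
Proof. by rewrite mxE; apply: eq_bigr => k _; rewrite !mxE mulrC. Qed.

(** The kernel of the frame operator S is trivial because <S f, f> is the squared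
    norm of Theta_F f. *)
Lemma frame_operator_unit N n (F : vectors N n) :
  is_frame F -> frame_operator F \in unitmx.
Proof.
move=> frF; rewrite -unitmx_tr -row_free_unit -kermx_eq0.
apply/eqP/row_matrixP => i; rewrite row0.
have := congr1 (row i) (mulmx_ker (frame_operator F)^T).
rewrite row_mul row0; move: (row i _) => w wS; apply: trmx_inj; rewrite trmx0.
apply: (frame_analysis_inj frF); apply: inner_eq0.
have Sw : frame_operator F *m w^T = 0 by rewrite -[LHS]trmxK trmx_mul trmxK wS trmx0.
rewrite inner_adj adjmx_mul -mulmxA [X in _ *m X]mulmxA Sw mulmx0.
by rewrite mxE.
Qed.

Lemma canonical_dualK N n (F : vectors N n) : is_frame F ->
  synthesis (canonical_dual F) *m analysis F = 1%:M.
Proof.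
by move=> /frame_operator_unit SF; rewrite synthesis_canonical_dual -mulmxA mulVmx.
Qed.

Lemma canonical_dual_pair N n (F : vectors N n) : is_frame F ->
  dual_pair F (canonical_dual F).
Proof.
move=> frF; have GF := canonical_dualK frF; split=> //; last exact/reconstructionP.
apply: (@left_inverse_is_frame _ _ _ (synthesis F)).
have := congr1 (fun M => M^t*) GF.
by rewrite /= adjmx_mul trmxCK trmx1 map_mx1.
Qed.

(** * Frames of n + 1 vectors with zero sum in dimension n *)

Lemma ones_analysis N n (F : vectors N n) : \sum_i F i = 0 ->
  const_mx 1 *m analysis F = 0 :> 'rV_n.
Proof.
move=> F0; apply/rowP => k; rewrite !mxE.
have /colP/(_ k) := F0; rewrite summxE mxE => /(congr1 Num.conj).
rewrite rmorph0 rmorph_sum/= => E; rewrite -[RHS]E.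
by apply: eq_bigr => i _; rewrite !mxE mul1r.
Qed.

(** A left invertible (n + 1) x n matrix has a left kernel of dimension one;
    if it contains the all-ones row, it is spanned by it. *)
Lemma corank1_left_kernel m n (T : 'M[C]_(n.+1, n)) (L : 'M[C]_(n, n.+1))
    (W : 'M[C]_(m, n.+1)) :
  L *m T = 1%:M -> const_mx 1 *m T = 0 :> 'rV_n -> W *m T = 0 ->
  exists h : 'cV_m, W = h *m const_mx 1.
Proof.
move=> LT oneT WT.
suff : (W <= (const_mx 1 : 'rV[C]_n.+1))%MS by move/submxP.
have rkT : \rank T = n.
  by apply/anti_leq; rewrite rank_leq_col -{1}(mxrank1 C n) -LT mxrankM_maxr.
have sub1 : ((const_mx 1 : 'rV[C]_n.+1) <= kermx T)%MS by apply/sub_kermxP.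
apply: submx_trans (_ : W <= kermx T)%MS _; first exact/sub_kermxP.
rewrite -(mxrank_leqif_sup sub1) mxrank_ker rkT subSnn rank_rV.
by rewrite eqb1; apply/eqP => /rowP/(_ 0)/eqP; rewrite !mxE oner_eq0.
Qed.

Section ZeroSum.
Variables (n : nat) (F : vectors n.+1 n).
Hypotheses (frF : is_frame F) (F0 : \sum_i F i = 0).

Lemma inner_canonical_dual i :
  inner (canonical_dual F i) (F i) = n%:R / n.+1%:R.
Proof.
set Phi := synthesis (canonical_dual F); set T := analysis F.
have PhiT : Phi *m T = 1%:M := canonical_dualK frF.
have oneT := ones_analysis F0.
have [|h hE] := @corank1_left_kernel _ _ T Phi (1%:M - T *m Phi) PhiT oneT.
  by rewrite mulmxBl mul1mx -mulmxA PhiT mulmx1 subrr.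
have Phi1 : Phi *m const_mx 1 = 0 :> 'cV_n.
  rewrite /Phi synthesis_canonical_dual -mulmxA.
  have := congr1 (fun M => M^t*) oneT; rewrite /= adjmx_mul trmx0 map_mx0.
  by rewrite trmx_const map_const_mx rmorph1 => ->; rewrite mulmx0.
(* Both sides of [hE] are applied to the all-ones column. *)
have hi : h i 0 * n.+1%:R = 1.
  have /colP/(_ i) := congr1 (mulmxr (const_mx 1 : 'cV_n.+1)) hE.
  rewrite /= mulmxBl mul1mx -!mulmxA Phi1 mulmx0 subr0 !mxE.
  rewrite big_ord1 !mxE (eq_bigr (fun=> 1)) => [|k _]; last by rewrite !mxE mulr1.
  by rewrite sumr_const card_ord => <-.
have /matrixP/(_ i i) := hE; rewrite !mxE eqxx big_ord1 mxE mulr1.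
have -> : \sum_j T i j * Phi j i = inner (canonical_dual F i) (F i).
  by apply: eq_bigr => k _; rewrite /Phi synthesis_coef /T mxE mulrC.
have n0 : n.+1%:R != 0 :> C by rewrite pnatr_eq0.
move=> E; apply: (mulIf n0); rewrite divfK//.
have -> : inner (canonical_dual F i) (F i) = 1 - h i 0.
  by rewrite -E opprB addrC subrK.
by rewrite mulrBl mul1r hi -natr1 addrK.
Qed.

Lemma zero_sum_dual_eq (G : vectors n.+1 n) : dual_pair F G ->
  (forall i, inner (G i) (F i) = n%:R / n.+1%:R) -> G = canonical_dual F.
Proof.
move=> [_ _ /reconstructionP GF] Gi.
set U := synthesis G - synthesis (canonical_dual F).
(* The rows of [U] lie in the left kernel, so all columns of [U] are equal to [h]. *)
have [|h hE] := @corank1_left_kernel _ _ (analysis F) _ U GF (ones_analysis F0).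
  by rewrite mulmxBl GF canonical_dualK// subrr.
have Gh i : G i = canonical_dual F i + h.
  apply/colP => k; have /matrixP/(_ k i) := hE.
  rewrite mxE [in X in _ + X]mxE !synthesis_coef [RHS]mxE big_ord1.
  rewrite [const_mx _ _ _]mxE mulr1.
  by move=> hk; rewrite [RHS]mxE -hk addrC subrK.
have h0 : h = 0.
  apply: (frame_analysis_inj frF); apply/colP => i; rewrite analysisE mxE.
  have := Gi i; rewrite Gh -(inner_canonical_dual i).
  have -> : inner (canonical_dual F i + h) (F i) =
            inner (canonical_dual F i) (F i) + inner h (F i).
    by rewrite -big_split/=; apply: eq_bigr => k _; rewrite mxE mulrDl.
  by move=> /eqP; rewrite -subr_eq0 addrAC subrr add0r => /eqP.
by apply/funext => i; rewrite Gh h0 addr0.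
Qed.

End ZeroSum.

Lemma optimal_error_zero_sum p n (F : vectors n.+1 n) :
  1 < p -> (0 < n)%N -> is_frame F -> \sum_i F i = 0 ->
  erasure_error p F (canonical_dual F) = n%:R / n.+1%:R /\
  @optimal_error R p n.+1 n = n%:R / n.+1%:R.
Proof.
move=> p1 n0 frF F0; have dF := canonical_dual_pair frF.
have Eopt : erasure_error p F (canonical_dual F) = n%:R / n.+1%:R.
  apply/esym/eqP; rewrite (erasure_error_leif p1 n0 _ dF)//.
  apply/forallP => i; rewrite inner_canonical_dual//.
  by rewrite fmorph_div !rmorph_nat.
split=> //; rewrite /optimal_error; set E := (X in inf X).
have EE : E (n%:R / n.+1%:R) by exists F, (canonical_dual F).
have lbE : lbound E (n%:R / n.+1%:R).
  by move=> _ [F' [G' [d ->]]]; apply: (erasure_error_leif p1 n0 _ d).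
apply/eqP; rewrite eq_le ge_inf//=; last by exists (n%:R / n.+1%:R).
by apply: lb_le_inf => //; exists (n%:R / n.+1%:R).
Qed.

End Frames.

Theorem theorem5p9 (R : realType) (p : R) (hp : 1 < p)
  (N : nat) (hN : (0 < N)%N)
  (e : rel 'I_N) (e_sym : symmetric e) (e_irr : irreflexive e)
  (e_conn : forall x y : 'I_N, connect e x y)
  (F : 'I_N -> 'cV[R[i]]_(N.-1))
  (hF : laplacian_frame e F) (hF0 : \sum_(i < N) F i = 0) :
  optimal_pairs p (F, canonical_dual F) /\
  (forall G' : 'I_N -> 'cV[R[i]]_(N.-1),
     dual_pair F G' -> G' <> canonical_dual F -> ~ optimal_pairs p (F, G')).
Proof.
have frF : is_frame F by case: hF => ? [? [? [_ _ _ _ []]]].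
have dF := canonical_dual_pair frF.
case: N hN e e_sym e_irr e_conn F {hF} hF0 frF dF => // -[|n] _ _ _ _ _ /= F F0 frF dF.
  (* The case N = 1, where the space is zero. *)
  have all_eq (G H : 'I_1 -> 'cV[R[i]]_0) : G = H.
    by apply/funext => i; rewrite [G i]flatmx0 [H i]flatmx0.
  split=> [|G' _ []]; last exact: all_eq.
  split=> //=; rewrite /optimal_error -[LHS]inf1; congr inf.
  apply/seteqP; split=> [_ ->|_ [F' [G' [_ ->]]]] /=.
    by exists F, (canonical_dual F).
  by rewrite (all_eq F' F) (all_eq G' (canonical_dual F)).
have [Ecan Eopt] := @optimal_error_zero_sum _ p _ F hp (ltn0Sn n) frF F0.
split=> [|G' dG' G'F [_ /=]]; first by split=> //=; rewrite Ecan Eopt.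
rewrite Eopt => /esym/eqP; rewrite (erasure_error_leif hp _ _ dG')// => /forallP Gi.
apply: G'F; apply: zero_sum_dual_eq => // i.
by rewrite (eqP (Gi i)) fmorph_div !rmorph_nat.
Qed.
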